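(* Let $\alpha \in \mathbb{R} \setminus \mathbb{Q}$ have continued fraction expansion $[a_0;a_1;a_2;\ldots]$, and let $f_\alpha$ be the rotation $x \mapsto x+\alpha \bmod 1$ of the unit torus. (i) If $a_i = 1$ for all sufficiently large $i$, then $$F_2(f_\alpha) = \frac{4\varphi+3}{10} = \frac{2\sqrt{5}+5}{10} > F_1(f_\alpha),$$ where $\varphi = \frac{1+\sqrt{5}}{2}$. (ii) If $a_i > 1$ for all sufficiently large $i$, then $$F_2(f_\alpha) = F_1(f_\alpha).$$
   Context: Let $\mathbb{T}_1 = [0,1)$ be the unit torus (endpoints glued), equipped with the Lebesgue probability measure $\mu$. For irrational $\alpha$, $f_\alpha:\mathbb{T}_1\to\mathbb{T}_1$ is $f_\alpha(x) = x+\alpha \bmod 1$. An interval is an arc of the torus that is closed on the left and open on the right, of positive length. For $n \in \mathbb{N}$ (positive integers) and a transformation $T$ of $\mathbb{T}_1$ preserving $\mu$, the covering number by $n$ intervals $F_n(T)$ is the supremum of all $z \in \mathbb{R}$ such that for every $h_0 \in \mathbb{N}$ there exist an integer $h \geq h_0$ and a set $B$ that is a union of $n$ pairwise disjoint intervals such that (1) $B, TB, \ldots, T^{h-1}B$ are pairwise disjoint, and (2) $\mu\left(\bigcup_{k=0}^{h-1} T^k B\right) \geq z$. The $n$ disjoint intervals making up $B$ are allowed to be adjacent (the right endpoint of one may equal the left endpoint of the next): up to rotation, $B = \bigcup_{i=1}^{n} [c_i, c_i+\beta_i)$ with $c_1 = 0$, $\beta_i>0$ and $c_i \geq c_{i-1}+\beta_{i-1}$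 for $2 \le i \le n$. *)

(* Defs.v *)
From HB Require Import structures.
From mathcomp Require Import all_boot all_order all_algebra.
From mathcomp Require Import all_classical all_reals all_analysis.

Set Implicit Arguments.
Unset Strict Implicit.
Unset Printing Implicit Defensive.

Import Order.TTheory GRing.Theory Num.Theory.
Import numFieldNormedType.Exports.

Local Open Scope classical_set_scope.
Local Open Scope ring_scope.

Definition frac {R : realType} (x : R) : R := x - (Num.floor x)%:~R.

(* The unit torus is the subset [0, 1) of R; a transformation of the torus is
   a function R -> R, of which only the values on [0, 1) are used. *)
Definition torus {R : realType} : set R := `[0, 1[.

Definition torus_measure {R : realType} : set R -> \bar R :=
  mrestr (@lebesgue_measure R) (measurable_itv `[0 : R, 1[).

Definition rotation {R : realType} (alpha x : R) : R := frac (x + alpha).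

(* The arc [c, c + b) taken modulo 1; it may wrap around 0. *)
Definition arc {R : realType} (c b : R) : set R := frac @` `[c, c + b[.

(* The arcs are nonempty, so trivIset forces arcs of distinct indices to be
   disjoint; two of them may still be adjacent. *)
Definition is_union_of_arcs {R : realType} (n : nat) (B : set R) : Prop :=
  exists c b : 'I_n -> R,
    [/\ forall i, torus (c i),
        forall i, 0 < b i <= 1,
        trivIset setT (fun i => arc (c i) (b i))
      & B = \bigcup_i arc (c i) (b i)].

Definition covers {R : realType} (n : nat) (T : R -> R) (z : R) : Prop :=
  forall h0 : nat, (0 < h0)%N ->
    exists (h : nat) (B : set R),
      [/\ (h0 <= h)%N,
          is_union_of_arcs n B,
          trivIset `I_h (fun k => iter k T @` B)
        & (z%:E <= torus_measure (\bigcup_(k in `I_h) (iter k T @` B)))%E].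

Definition covering_number {R : realType} (n : nat) (T : R -> R) : \bar R :=
  ereal_sup [set z%:E | z in [set z : R | covers n T z]].

(* For irrational alpha no complete quotient is an integer, so the inverse is
   never taken at 0. *)
Fixpoint complete_quotient {R : realType} (alpha : R) (i : nat) : R :=
  if i is j.+1 then (frac (complete_quotient alpha j))^-1 else alpha.

Definition partial_quotient {R : realType} (alpha : R) (i : nat) : int :=
  Num.floor (complete_quotient alpha i).

Definition golden_ratio {R : realType} : R := (1 + Num.sqrt 5) / 2.

(* Main.v *)
From Pilot Require Import Defs.
From HB Require Import structures.
From mathcomp Require Import all_boot all_order all_algebra.
From mathcomp Require Import all_classical all_reals all_analysis.
From mathcomp Require Import ring lra zify.
(* [mathcomp.algebra.fraction] also exports a [frac]. *)
Import Pilot.Defs.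

(* Write [q_n] for the denominators of the convergents of [alpha] and [e_n] for
   the distance of [q_n * alpha] to the integers. If [T^k B], [k < h], are
   disjoint, each arc of [B] has length at most [e_n] as soon as [h > q_n], and
   the sum of the lengths of two arcs of [B] is at most the largest gap between
   the [2h - 1] points [k * alpha], [|k| < h]. Hence [F_1] is the limsup of
   [v_n = q_(n+1) * e_n], and for two arcs:
   - if [q_n < h <= q_(n+1)] and [a_i > 1], the total measure is at most [v_n],
     unless [q_(n+1) < 2h <= q_n + q_(n+1)], when the gap is
     [e_n + e_(n+1)] and the measure is bounded by the average
     [v_n / 2 + v_(n-1) / 4 + v_(n+1) / 4];
   - if [a_i = 1], the best choice is [2h] close to [q_(n+2)], where a gap of
     length [e_(n-1) = e_n + e_(n+1)] remains and is filled by two arcs of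
     lengths [e_n] and [e_(n+1)]; then [h * e_(n-1)] tends to
     [(4 * phi + 3) / 10]. *)

Set Implicit Arguments.
Unset Strict Implicit.
Unset Printing Implicit Defensive.

Import Order.TTheory GRing.Theory Num.Theory.
Import numFieldNormedType.Exports.

Local Open Scope classical_set_scope.
Local Open Scope ring_scope.

(** * Fractional parts and irrationality *)

Section Frac.
Variable R : realType.
Implicit Types (x y : R) (m : int).

Lemma frac_itv x : 0 <= frac x < 1.
Proof.
have /andP[h1 h2] := floor_itv x.
rewrite intrD in h2; rewrite /frac; apply/andP; split; lra.
Qed.

Lemma frac_int x : {m : int | frac x = x + m%:~R}.
Proof. by exists (- Num.floor x); rewrite /frac mulrNz. Qed.

Lemma int_small m : -1 < (m%:~R : R) < 1 -> m = 0.
Proof.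
move=> /andP[h1 h2]; have {}h1 : -1 < m by rewrite -(ltr_int R) mulrNz.
have {}h2 : m < 1 by rewrite -(ltr_int R).
lia.
Qed.

Lemma frac_id x m : 0 <= x + m%:~R < 1 -> frac x = x + m%:~R.
Proof.
move=> h; have h' := frac_itv x; have [k Ek] := frac_int x.
suff -> : m = k by [].
apply/eqP; rewrite -subr_eq0; apply/eqP/int_small; rewrite intrB.
move: h h' => /andP[h1 h2] /andP[h3 h4]; apply/andP; split; lra.
Qed.

Lemma irrational_intr x m : irrational x -> x != m%:~R.
Proof.
move=> irr; apply/eqP => xm; apply: irr; exists m%:~R => //.
by rewrite ratr_int xm.
Qed.

Lemma irrational_lin x (a b : int) : irrational x -> a != 0 ->
  a%:~R * x + b%:~R != 0.
Proof.
move=> irr a0; apply/eqP => e; apply: irr; exists (- b%:~R / a%:~R) => //.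
rewrite fmorph_div rmorphN /= !ratr_int.
have a0' : (a%:~R : R) != 0 by rewrite intr_eq0.
by apply: (mulfI a0'); rewrite mulrCA divff // mulr1; lra.
Qed.

Lemma frac_irrational x : irrational x -> irrational (frac x)^-1.
Proof.
move=> irr [q _ e]; have [m Em] := frac_int x; apply: irr.
exists (q^-1 - m%:~R) => //.
by rewrite rmorphB fmorphV /= ratr_int e invrK Em addrK.
Qed.

End Frac.

(** * Convergents, their errors, and best approximation *)

Section ContinuedFraction.
Variables (R : realType) (alpha : R).
Hypothesis irr : irrational alpha.

Local Notation cq := (complete_quotient alpha).
Local Notation pq := (partial_quotient alpha).

(* Both sequences start at the index -1 of the usual convergents, so that
   [num n / den n] is the convergent of index [n - 1]. *)
Fixpoint den (n : nat) : int :=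
  match n with
  | 0 => 0 | 1 => 1
  | (m.+1 as k).+1 => pq k * den k + den m
  end.

Fixpoint num (n : nat) : int :=
  match n with
  | 0 => 1 | 1 => pq 0
  | (m.+1 as k).+1 => pq k * num k + num m
  end.

(** A product of fractional parts, which [den_lin] identifies with the absolute value of
    [den n * alpha - num n]. *)
Fixpoint err (n : nat) : R :=
  if n is m.+1 then err m * frac (cq m) else 1.

Lemma denSS n : den n.+2 = pq n.+1 * den n.+1 + den n. Proof. by []. Qed.
Lemma numSS n : num n.+2 = pq n.+1 * num n.+1 + num n. Proof. by []. Qed.

Lemma cq_irr n : irrational (cq n).
Proof. by elim: n => //= n /frac_irrational. Qed.

Lemma frac_cq_gt0 n : 0 < frac (cq n).
Proof.
have /andP[h _] := frac_itv (cq n); rewrite lt_neqAle h andbT eq_sym.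
have [m ->] := frac_int (cq n).
by rewrite addr_eq0 -mulrNz; apply: irrational_intr; exact: cq_irr.
Qed.

Lemma cqE n : cq n = (pq n)%:~R + frac (cq n).
Proof. by rewrite /frac /partial_quotient addrC subrK. Qed.

Lemma pq_ge1 n : 1 <= pq n.+1.
Proof.
rewrite /partial_quotient floor_ge_int /=.
have /andP[_ h] := frac_itv (cq n).
by rewrite invf_ge1 ?frac_cq_gt0 // ltW.
Qed.

Lemma err_gt0 n : 0 < err n.
Proof. by elim: n => //= n h; rewrite mulr_gt0 // frac_cq_gt0. Qed.

Lemma err_rec n : err n = (pq n.+1)%:~R * err n.+1 + err n.+2.
Proof.
have h := frac_cq_gt0 n; have := cqE n.+1; rewrite /= => e.
set f := frac (frac (cq n))^-1 in e *.
transitivity (err n * frac (cq n) * (frac (cq n))^-1).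
  by rewrite mulfK // gt_eqF.
by rewrite e; ring.
Qed.

Lemma err_ltS n : err n.+1 < err n.
Proof.
rewrite /= -[ltRHS]mulr1 ltr_pM2l ?err_gt0 //.
by have /andP[] := frac_itv (cq n).
Qed.

Lemma err_le m n : (m <= n)%N -> err n <= err m.
Proof.
elim: n => [|n IH]; first by rewrite leqn0 => /eqP ->.
rewrite leq_eqVlt => /orP[/eqP->//|/IH]; apply: le_trans.
exact/ltW/err_ltS.
Qed.

Lemma err_le1 n : err n <= 1.
Proof. exact: (err_le (leq0n n)). Qed.

(** By [err_rec] the signed errors obey the recurrence of [den] and [num]; the alternating sign
    turns its subtraction into an addition. *)
Lemma den_lin n : (den n)%:~R * alpha - (num n)%:~R = (-1) ^+ n.+1 * err n.
Proof.
elim/ltn_ind: n => -[|[|n]] IH.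
- by rewrite /=; ring.
- by rewrite /= /frac /partial_quotient /= ; ring.
- rewrite denSS numSS.
  have := IH n.+1 (ltnSn _); have := IH n (ltnW (ltnSn _)).
  have := err_rec n.
  rewrite !intrD !intrM !exprS => e h1 h2.
  transitivity ((pq n.+1)%:~R * ((den n.+1)%:~R * alpha - (num n.+1)%:~R)
     + ((den n)%:~R * alpha - (num n)%:~R)); first ring.
  by rewrite h1 h2 e; ring.
Qed.

Lemma den_det n : den n.+1 * num n - den n * num n.+1 = (-1) ^+ n.
Proof.
elim: n => [|n IH]; first by rewrite /=; ring.
rewrite denSS numSS exprS -IH; ring.
Qed.

(** The recurrences of [den] and [err] leave this sum invariant. Geometrically, two towers of
    heights [den n.+1] and [den n] fill the torus. *)
Lemma den_err n : (den n.+1)%:~R * err n + (den n)%:~R * err n.+1 = 1.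
Proof.
elim: n => [|n IH]; first by rewrite /=; ring.
by rewrite -[RHS]IH denSS (err_rec n) intrD intrM; ring.
Qed.

Lemma den_ge0 n : 0 <= den n.
Proof.
elim/ltn_ind: n => -[|[|n]] IH //.
rewrite denSS; have := IH n.+1 (ltnSn _); have := IH n (ltnW (ltnSn _)).
have := pq_ge1 n; nia.
Qed.

Lemma den_gt0 n : 0 < den n.+1.
Proof.
elim: n => // n IH; rewrite denSS.
have := den_ge0 n; have := pq_ge1 n; nia.
Qed.

Lemma den_le n : den n <= den n.+1.
Proof.
case: n => // n; rewrite denSS.
have := den_ge0 n; have := den_ge0 n.+1; have := pq_ge1 n; nia.
Qed.

Lemma den_ge n : n%:Z <= den n.+1.
Proof.
elim: n => // n IH; rewrite denSS.
case: n IH => [|n] IH; first by have := pq_ge1 0; rewrite /=; lia.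
have := den_gt0 n; have := den_gt0 n.+1; have := pq_ge1 n.+1; nia.
Qed.

(** Since [den] grows at least linearly, there is a largest index at which it is still at most
    [M]. *)
Lemma den_bracket N (M : int) : den N <= M ->
  exists2 n, (N <= n)%N & den n <= M < den n.+1.
Proof.
move=> NM; pose P n := (N <= n)%N && (den n <= M).
have Pub n : P n -> (n <= `|M|.+1)%N.
  case/andP=> _; case: n => // n; have := den_ge n; lia.
have exP : exists n, P n by exists N; rewrite /P leqnn.
case: (ex_maxnP exP Pub) => n /andP[Nn nM] nmax; exists n => //.
rewrite nM /= ltNge; apply/negP => h.
by have := nmax n.+1; rewrite /P h ltnn (leqW Nn) => /(_ isT).
Qed.

(* The pairs [(den n, num n)] and [(den n.+1, num n.+1)] form a basis of Z^2,
   so [j = x * den n + y * den n.+1] for integers [x], [y] with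
   [j * alpha - m = +-(x * err n - y * err n.+1)]. *)
Lemma gap_between (n : nat) (j m : int) :
  0 < (-1) ^+ n.+1 * (j%:~R * alpha - m%:~R) < err n ->
  den n + den n.+1 <= j \/ j <= - den n.+1.
Proof.
pose s : int := (-1) ^+ n.
pose x := s * (den n.+1 * m - num n.+1 * j).
pose y := s * (j * num n - m * den n).
have s2 : s * s = 1 by rewrite /s -expr2 sqrr_sign.
have det := den_det n; rewrite -/s in det.
have Ej : j = x * den n + y * den n.+1.
  transitivity (j * (s * s)); first by rewrite s2 mulr1.
  by rewrite -{2}det /x /y; ring.
have Em : m = x * num n + y * num n.+1.
  transitivity (m * (s * s)); first by rewrite s2 mulr1.
  by rewrite -{2}det /x /y; ring.
clearbody x y.
have -> : (-1) ^+ n.+1 * (j%:~R * alpha - m%:~R) =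
    x%:~R * err n - y%:~R * err n.+1.
  rewrite Ej Em !intrD !intrM.
  transitivity ((-1) ^+ n.+1 * (x%:~R * ((den n)%:~R * alpha - (num n)%:~R)
    + y%:~R * ((den n.+1)%:~R * alpha - (num n.+1)%:~R))); first by ring.
  rewrite !den_lin.
  transitivity (((-1) ^+ n * (-1) ^+ n) * (x%:~R * err n - y%:~R * err n.+1)).
    by rewrite !exprS; ring.
  by rewrite -expr2 sqrr_sign mul1r.
move=> /andP[h1 h2].
have e0 := err_gt0 n; have e1 := err_gt0 n.+1; have e10 := err_ltS n.
have d0 := den_ge0 n; have d1 := den_gt0 n.
(* If [y < 0], the upper bound forces [x <= 0]; if [y > 0], positivity forces [x >= 1]; if [y = 0],
   then [x] would lie strictly between 0 and 1. *)
have [y0|y0|y0] := ltgtP y 0.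
- right; have x0 : x <= 0.
    rewrite leNgt; apply/negP => x1.
    have {}x1 : (1 : R) <= x%:~R by rewrite (ler_int R 1).
    have {}y0 : (y%:~R : R) <= 0 by rewrite (ler_int R _ 0) ltW.
    have := ler_wpM2r (ltW e0) x1; have := ler_wpM2r (ltW e1) y0; lra.
  nia.
- left; have x0 : 1 <= x.
    rewrite leNgt; apply/negP => x1.
    have {}x1 : (x%:~R : R) <= 0 by rewrite (ler_int R _ 0); lia.
    have {}y0 : (0 : R) <= y%:~R by rewrite (ler_int R 0) ltW.
    have := ler_wpM2r (ltW e0) x1; have := ler_wpM2r (ltW e1) y0; lra.
  nia.
- exfalso; rewrite y0 mul0r subr0 in h1 h2.
  have [x1|x1] := lerP x 0.
    have {}x1 : (x%:~R : R) <= 0 by rewrite (ler_int R _ 0).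
    have := ler_wpM2r (ltW e0) x1; lra.
  have {}x1 : (1 : R) <= x%:~R by rewrite (ler_int R 1).
  have := ler_wpM2r (ltW e0) x1; lra.
Qed.

(** A smaller value would contradict [gap_between] for [(j, m)] or [(- j, - m)], according to its
    sign; irrationality excludes the value 0. *)
Lemma best_approx (n : nat) (j m : int) : j != 0 -> `|j| < den n.+1 ->
  err n <= `|j%:~R * alpha - m%:~R|.
Proof.
move=> j0 jd; rewrite leNgt; apply/negP => lt.
pose t := (-1) ^+ n.+1 * (j%:~R * alpha - m%:~R).
have d0 := den_ge0 n.
have nt : `|t| < err n by rewrite normrM normrX normrN1 expr1n mul1r.
have [t0|t0|t0] := ltgtP t 0.
- have := @gap_between n (- j) (- m).
  have -> : (-1) ^+ n.+1 * ((- j)%:~R * alpha - (- m)%:~R) = - t.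
    by rewrite /t !mulrNz; ring.
  rewrite ltr0_norm // in nt; rewrite nt oppr_gt0 t0 => /(_ isT); lia.
- have := @gap_between n j m; rewrite -/t t0.
  rewrite gtr0_norm // in nt; rewrite nt => /(_ isT); lia.
- have := @irrational_lin _ alpha j (- m) irr j0.
  move: t0 => /eqP; rewrite mulf_eq0 signr_eq0 /= mulrNz => ->; done.
Qed.

End ContinuedFraction.

Arguments den : simpl never.
Arguments num : simpl never.
Arguments err : simpl never.

(* From [k] in the window, [k + a] or [k - b] is again in the window, and both
   moves push [k * alpha] modulo 1 to the right, by [A] and by [B]: iterating
   them one cannot step over an interval longer than [A] and [B]. *)
Lemma window_hits (R : realType) (alpha A B u : R) (a b p q w : int) :
  0 <= a -> 0 <= b -> 0 < a + b ->
  a%:~R * alpha - p%:~R = A -> q%:~R - b%:~R * alpha = B ->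
  0 < A -> 0 < B ->
  exists k m : int, (w <= k < w + a + b) &&
    (u < k%:~R * alpha + m%:~R <= u + Num.max A B).
Proof.
move=> a0 b0 ab EA EB A0 B0; apply: contrapT => /forallNP nohit.
pose pos (k m : int) : R := k%:~R * alpha + m%:~R.
have stop k m : w <= k < w + a + b -> pos k m <= u + Num.max A B ->
    pos k m <= u.
  move=> kw km; rewrite leNgt; apply/negP => ukm.
  by apply: (nohit k); exists m; rewrite kw ukm.
have AM : A <= Num.max A B by rewrite le_max lexx.
have BM : B <= Num.max A B by rewrite le_max lexx orbT.
have Am : Num.min A B <= A by rewrite ge_min lexx.
have Bm : Num.min A B <= B by rewrite ge_min lexx orbT.
pose m0 := Num.floor (u - w%:~R * alpha).
have m0P : pos w m0 <= u.
  by have := floor_le_tmp (u - w%:~R * alpha); rewrite /pos /m0; lra.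
(* Without a hit, every move gains at least [Num.min A B] and yet stays below [u], which is absurd
   for large [n]. *)
have far n : exists k m : int, [/\ w <= k < w + a + b, pos k m <= u
    & pos w m0 + n%:R * Num.min A B <= pos k m].
  elim: n => [|n [k [m [kw kmu nkm]]]].
    by exists w, m0; split => //; [lia | rewrite mul0r addr0].
  have [ka|ka] := ltP k (w + b).
    have e : pos (k + a) (m - p) = pos k m + A.
      by rewrite /pos -EA; ring.
    exists (k + a), (m - p); split; [lia| |].
      by apply: stop; [lia| rewrite e; lra].
    by rewrite e mulrSr mulrDl mul1r; lra.
  have e : pos (k - b) (m + q) = pos k m + B.
    by rewrite /pos -EB; ring.
  exists (k - b), (m + q); split; [lia| |].
    by apply: stop; [lia| rewrite e; lra].
  by rewrite e mulrSr mulrDl mul1r; lra.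
have min0 : 0 < Num.min A B by rewrite lt_min A0 B0.
pose n := Num.bound ((u - pos w m0) / Num.min A B).
have [k [m [_ h1 h2]]] := far n.
have : (u - pos w m0) / Num.min A B < n%:R.
  by apply: archi_boundP; apply: divr_ge0; [rewrite subr_ge0 | exact: ltW].
rewrite ltr_pdivrMr //; lra.
Qed.

(** * Arcs of the torus: rotation, measure, intersection *)

Section Arcs.
Variable R : realType.
Implicit Types (c b x y alpha : R).

Lemma arcP c b x :
  arc c b x <-> 0 <= x < 1 /\ exists m : int, c <= x + m%:~R < c + b.
Proof.
split=> [[y /=]|[x01 [m h]]].
  rewrite in_itv /= => ycb <-; split; first exact: frac_itv.
  have [m ->] := frac_int y; exists (- m).
  by rewrite mulrNz addrK.
exists (x + m%:~R); first by rewrite /= in_itv.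
by rewrite (@frac_id _ _ (- m)) mulrNz addrK.
Qed.

Lemma frac_frac_add x y : frac (frac x + y) = frac (x + y).
Proof.
have [m ->] := frac_int x; have [k ek] := frac_int (x + y).
rewrite (@frac_id _ (x + m%:~R + y) (k - m)) intrB.
  by rewrite ek; ring.
have := frac_itv (x + y); rewrite ek.
by have -> : x + m%:~R + y + (k%:~R - m%:~R) = x + y + k%:~R by ring.
Qed.

Lemma rotation_arc alpha c b : rotation alpha @` arc c b = arc (c + alpha) b.
Proof.
rewrite /arc; apply/seteqP; split => x /=.
  move=> [_ [y ycb <-] <-]; exists (y + alpha); last first.
    by rewrite /rotation frac_frac_add.
  by move: ycb; rewrite /= !in_itv /=; lra.
move=> [y ycb <-]; exists (frac (y - alpha)).
  by exists (y - alpha) => //; move: ycb; rewrite /= !in_itv /=; lra.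
by rewrite /rotation frac_frac_add subrK.
Qed.

Lemma iter_rotation_arcs n alpha (c b : 'I_n -> R) k :
  iter k (rotation alpha) @` (\bigcup_i arc (c i) (b i)) =
  \bigcup_i arc (c i + k%:R * alpha) (b i).
Proof.
elim: k => [|k IH].
  by rewrite image_id; apply: eq_bigcupr => i _; rewrite mul0r addr0.
transitivity (rotation alpha @`
    (iter k (rotation alpha) @` \bigcup_i arc (c i) (b i))).
  by rewrite -image_comp.
rewrite IH image_bigcup; apply: eq_bigcupr => i _.
by rewrite rotation_arc mulrSr mulrDl mul1r addrA.
Qed.

Lemma arc_frac c b : arc (frac c) b = arc c b.
Proof.
have [m ->] := frac_int c.
apply/seteqP; split => x /arcP[x01 [k h]]; apply/arcP; split => //.
  by exists (k - m); rewrite intrB; lra.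
by exists (k + m); rewrite intrD; lra.
Qed.

(** An arc of length at most 1 wraps around at most once; the second interval is empty when it does
    not wrap. *)
Lemma arc_itv c b : 0 <= c < 1 -> 0 < b <= 1 ->
  arc c b = `[c, Num.min (c + b) 1[ `|` `[0, c + b - 1[.
Proof.
move=> /andP[c0 c1] /andP[b0 b1]; apply/seteqP; split => x.
  move=> /arcP[/andP[x0 x1] [m /andP[h1 h2]]] /=; rewrite !in_itv /= lt_min.
  have : (m == 0) || (m == 1).
    have : (m%:~R : R) < 2%:~R by lra.
    have : ((- 1%:Z)%:~R : R) < m%:~R by rewrite mulrNz; lra.
    rewrite !ltr_int; lia.
  by case/orP => /eqP e; rewrite e in h1 h2; [left|right];
    rewrite ?addr0 in h1 h2; lra.
move=> /= h; apply/arcP; case: h; rewrite in_itv /= ?lt_min => h.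
  by split; [lra | exists 0; rewrite addr0; lra].
by split; [lra | exists 1; lra].
Qed.

Lemma measurable_arc c b : 0 < b <= 1 -> measurable (arc c b).
Proof.
move=> b01; rewrite -arc_frac arc_itv ?frac_itv //; exact: measurableU.
Qed.

Lemma torus_measure_arc c b : 0 < b <= 1 -> torus_measure (arc c b) = b%:E.
Proof.
move=> b01; rewrite -arc_frac /torus_measure /mrestr setIidl; last first.
  by move=> x /arcP[h _]; rewrite /= in_itv.
rewrite arc_itv ?frac_itv //.
have /andP[c0 c1] := frac_itv c; move/andP: b01 => [b0 b1].
move: (frac c) c0 c1 => f f0 f1.
rewrite measureU //; last first.
  apply/seteqP; split => // x [] /=; rewrite !in_itv /= lt_min; lra.
rewrite /= !lebesgue_measure_itv /= !lte_fin lt_min f1 ltrDl b0 /=.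
rewrite minEle; case: ifP => h1; case: ifP => h2;
  rewrite /= -?EFinB -?EFinD ?adde0; congr EFin; lra.
Qed.

End Arcs.

Lemma arc_meet (R : realType) (c b c' b' : R) : 0 < b -> 0 < b' ->
  arc c b `&` arc c' b' !=set0 <->
  exists m : int, - b' < c' + m%:~R - c < b.
Proof.
move=> b0 b'0.
split=> [[x [/arcP[_ [m hm]] /arcP[_ [k hk]]]]|[m hm]].
  by exists (m - k); rewrite intrB; lra.
have [y [y1 y2]] : exists y, c <= y < c + b /\ c' <= y - m%:~R < c' + b'.
  (* The larger of the two left endpoints, in suitable lifts, is a common point. *)
  by exists (Num.max c (c' + m%:~R)); rewrite maxEle; case: ifP => h; lra.
have [e Ee] := frac_int y.
exists (frac y); split; apply/arcP; (split; first exact: frac_itv).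
  by exists (- e); rewrite Ee mulrNz; lra.
by exists (- e - m); rewrite Ee intrB mulrNz; lra.
Qed.

(** * Towers of disjoint arcs, and covering as an arithmetic condition *)

Section Towers.
Variables (R : realType) (n h : nat) (alpha : R) (c b : 'I_n -> R).

(* The [n * h] arcs [arc (c i + k * alpha) (b i)] with [k < h] are disjoint. *)
Definition disjoint_tower := forall i j (k l : nat) (m : int),
  (k < h)%N -> (l < h)%N ->
  - b j < c j + l%:R * alpha + m%:~R - (c i + k%:R * alpha) < b i ->
  i = j /\ k = l.

Hypothesis b01 : forall i, 0 < b i <= 1.
Let stage k := \bigcup_i arc (c i + k%:R * alpha) (b i).

Lemma disjoint_towerP : (0 < h)%N -> disjoint_tower <->
  trivIset setT (fun i => arc (c i) (b i)) /\ trivIset `I_h stage.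
Proof.
have b0 i : 0 < b i by case/andP: (b01 i).
move=> h0; split=> [dis|[tb ts] i j k l m kh lh hm].
  split=> [i j _ _ /arc_meet[] // m hm|].
    by have [] := dis i j 0 0 m h0 h0; rewrite ?mul0r ?addr0.
  move=> k l /= kh lh [x [[i _ xi] [j _ xj]]].
  have /arc_meet[] // : arc (c i + k%:R * alpha) (b i) `&`
     arc (c j + l%:R * alpha) (b j) !=set0 by exists x.
  by move=> m /dis[].
(* Two stages that meet have the same index, after which the translation by [k * alpha] cancels. *)
have kl : k = l.
  apply: ts => //.
  have /arc_meet[] // : exists m : int, - b j <
    c j + l%:R * alpha + m%:~R - (c i + k%:R * alpha) < b i by exists m.
  by move=> x [xi xj]; exists x; split; [exists i | exists j].
split=> //; apply: tb => //; apply/arc_meet => //; exists m.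
by move: hm; rewrite kl; lra.
Qed.

Lemma torus_measure_tower : (0 < h)%N -> disjoint_tower ->
  torus_measure (\bigcup_(k in `I_h) stage k) = (h%:R * \sum_i b i)%:E.
Proof.
move=> h0 dis; have [_ ts] := (disjoint_towerP h0).1 dis.
have b0 i : 0 < b i by case/andP: (b01 i).
have stageE k :
    stage k = \big[setU/set0]_(i < n) arc (c i + k%:R * alpha) (b i).
  rewrite -bigcup_seq; apply: eq_bigcupl.
  by split => i _ //=; exact: mem_index_enum.
have ms k : measurable (stage k).
  by rewrite stageE; apply: bigsetU_measurable => i _; exact: measurable_arc.
(* The restricted Lebesgue measure is repackaged as a measure, so that finite additivity applies to
   it. *)
pose mu : {measure set (g_sigma_algebraType R.-ocitv.-measurable) -> \bar R} :=
  mrestr (@lebesgue_measure R) (measurable_itv `[0 : R, 1[).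
rewrite -[torus_measure]/(mu : set R -> \bar R).
rewrite bigcup_mkord measure_semi_additive_ord_I //; last 2 first.
- by move=> k _; exact: ms.
- by apply: (@bigsetU_measurable _ (g_sigma_algebraType _)) => k _; exact: ms.
rewrite (eq_bigr (fun=> (\sum_i b i)%:E)) => [|k _].
  by rewrite sumEFin big_const_ord iter_addr addr0 mulr_natl.
rewrite stageE measure_semi_additive_ord //; last 3 first.
- by move=> i; exact: measurable_arc.
- move=> i j _ _ /arc_meet[] // m hm.
  by have [] := dis i j k k m (ltn_ord k) (ltn_ord k) hm.
- apply: (@bigsetU_measurable _ (g_sigma_algebraType _)) => i _.
  exact: measurable_arc.
by rewrite -sumEFin; apply: eq_bigr => i _; exact: torus_measure_arc.
Qed.

End Towers.

(** From here on sets and measures disappear: only endpoints, lengths and heights remain. *)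
Lemma coversP (R : realType) (n : nat) (alpha z : R) :
  covers n (rotation alpha) z <->
  forall h0 : nat, exists (h : nat) (c b : 'I_n -> R),
    [/\ (h0 <= h)%N, forall i, 0 < b i <= 1, disjoint_tower h alpha c b
      & z <= h%:R * \sum_i b i].
Proof.
split=> [cov h0|cov h0 h00].
  have [//|h [B [hh [c [b [cT b01 tb EB]]] th zh]]] := cov h0.+1.
  have hpos : (0 < h)%N by exact: leq_ltn_trans hh.
  exists h, c, b.
  have E : (fun k => iter k (rotation alpha) @` B) =
      fun k => \bigcup_i arc (c i + k%:R * alpha) (b i).
    by apply/funext => k; rewrite EB iter_rotation_arcs.
  rewrite E in th zh.
  have dis : disjoint_tower h alpha c b by apply/disjoint_towerP.
  split=> //; first exact: ltnW.
  by move: zh; rewrite torus_measure_tower.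
have [h [c [b [hh b01 dis zh]]]] := cov h0.
have hpos : (0 < h)%N by exact: leq_trans hh.
have [tb th] := (disjoint_towerP alpha c b01 hpos).1 dis.
pose B := \bigcup_i arc (c i) (b i).
have E : (fun k => iter k (rotation alpha) @` B) =
    fun k => \bigcup_i arc (c i + k%:R * alpha) (b i).
  by apply/funext => k; rewrite iter_rotation_arcs.
exists h, B; split => //.
(* Left endpoints must lie in the torus; reducing them modulo 1 does not change the arcs. *)
- exists (fun i => frac (c i)), b; split => //.
  + by move=> i; rewrite /torus /= in_itv; exact: frac_itv.
  + by under eq_fun do rewrite arc_frac.
  + by apply: eq_bigcupr => i _; rewrite arc_frac.
- by rewrite E.
- by rewrite E torus_measure_tower.
Qed.

(** * Upper bounds on the arcs of a tall tower *)

Section TowerBounds.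
Variables (R : realType) (n h : nat) (alpha : R) (c b : 'I_n -> R).
Hypothesis irr : irrational alpha.
Hypothesis b01 : forall i, 0 < b i <= 1.
Hypothesis dis : disjoint_tower h alpha c b.

(** Differences of two levels below [h] are exactly the integers [k] with [|k| < h]. *)
Lemma tower_avoid i j (k m : int) : `|k| < h%:Z ->
  - b j < c j - c i + k%:~R * alpha + m%:~R < b i -> i = j /\ k = 0.
Proof.
move=> kh hm.
have [l [l' [lh l'h El]]] : exists l l' : nat,
    [/\ (l < h)%N, (l' < h)%N & k = l%:Z - l'%:Z].
  by case: k {hm} kh => k kh; [exists k, 0%N | exists 0%N, k.+1]; split; lia.
have [|-> e] := @dis i j l' l m l'h lh.
  by move: hm; rewrite El intrB -!pmulrn; lra.
by split=> //; rewrite El e subrr.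
Qed.

(** After [den m] steps an arc comes back displaced by [err m], so a longer arc would meet its own
    image. *)
Lemma tower_width m i : 0 < den alpha m -> den alpha m < h%:Z ->
  b i <= err alpha m.
Proof.
move=> d0 dh; rewrite leNgt; apply/negP => lt.
have [||_ e] := @tower_avoid i i (den alpha m) (- num alpha m).
- by rewrite gtr0_norm.
- rewrite mulrNz subrr add0r den_lin //.
  rewrite -ltr_norml normrM normrX normrN1 expr1n mul1r gtr0_norm //.
  exact: err_gt0.
- by rewrite e in d0.
Qed.

(** The points [k * alpha] with [|k| < h] must avoid modulo 1 an interval of length [b i + b j],
    while [window_hits] finds one of them in any interval longer than both moves. The sign [s] says
    which of [x] and [y] moves to the right. *)
Lemma tower_gap (s : bool) i j (x y p q : int) (A B : R) : i != j ->
  0 <= x -> 0 <= y -> 0 < x + y < 2 * h%:Z ->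
  (-1) ^+ s * (x%:~R * alpha - p%:~R) = A ->
  (-1) ^+ s * (q%:~R - y%:~R * alpha) = B ->
  0 < A -> 0 < B -> b i + b j <= Num.max A B.
Proof.
move=> ij x0 y0 /andP[xy0 xyh] EA EB A0 B0; rewrite leNgt; apply/negP => lt.
have [k [m /andP[kw hit]]] : exists k m : int,
    (1 - h%:Z <= k < 1 - h%:Z + x + y) &&
    (* The half-open interval lies inside the open forbidden one because [lt] is strict. *)
    (c i - c j - b j < k%:~R * alpha + m%:~R <=
      c i - c j - b j + Num.max A B).
  case: s EA EB => EA EB.
    have EB' : y%:~R * alpha - q%:~R = B by rewrite -EB; ring.
    have EA' : p%:~R - x%:~R * alpha = A by rewrite -EA; ring.
    have yx0 : 0 < y + x by rewrite addrC.
    have [k [m h1]] := window_hits (c i - c j - b j) (1 - h%:Z)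
      y0 x0 yx0 EB' EA' B0 A0.
    by exists k, m; move: h1; rewrite maxC -!addrA (addrC y).
  have EA' : x%:~R * alpha - p%:~R = A by rewrite -EA; ring.
  have EB' : q%:~R - y%:~R * alpha = B by rewrite -EB; ring.
  have [k [m h1]] := window_hits (c i - c j - b j) (1 - h%:Z)
    x0 y0 xy0 EA' EB' A0 B0.
  by exists k, m.
have [||e _] := @tower_avoid i j k m; [lia | lra |].
by rewrite e eqxx in ij.
Qed.

Lemma tower_gap_den m i j : i != j ->
  den alpha m + den alpha m.+1 < 2 * h%:Z -> b i + b j <= err alpha m.
Proof.
move=> ij dh; have d0 := den_ge0 irr m; have d1 := den_gt0 irr m.
have e0 := err_gt0 irr m; have e1 := err_gt0 irr m.+1.
have -> : err alpha m = Num.max (err alpha m) (err alpha m.+1).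
  by rewrite max_l // ltW // err_ltS.
have L0 := den_lin irr m; have L1 := den_lin irr m.+1.
apply: (@tower_gap (odd m.+1) i j (den alpha m) (den alpha m.+1)
  (num alpha m) (num alpha m.+1)) => //.
- lia.
- lia.
- by rewrite L0 signr_odd mulrA -expr2 sqrr_sign mul1r.
- rewrite -opprB L1 signr_odd [(-1) ^+ m.+2]exprS.
  transitivity ((-1) ^+ m.+1 * (-1) ^+ m.+1 * err alpha m.+1); first by ring.
  by rewrite -expr2 sqrr_sign mul1r.
Qed.

(** Replacing the move [den m.+1] by [den m.+1 - den m] shortens the window to [den m.+1], at the
    price of a move of length [err m + err m.+1]. *)
Lemma tower_gap_den1 m i j : i != j ->
  den alpha m.+1 < 2 * h%:Z -> b i + b j <= err alpha m + err alpha m.+1.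
Proof.
move=> ij dh; have d0 := den_ge0 irr m; have d1 := den_gt0 irr m.
have d01 := den_le irr m.
have e0 := err_gt0 irr m; have e1 := err_gt0 irr m.+1.
have -> : err alpha m + err alpha m.+1 =
    Num.max (err alpha m) (err alpha m + err alpha m.+1).
  by rewrite max_r // lerDl ltW.
have L0 := den_lin irr m; have L1 := den_lin irr m.+1.
apply: (@tower_gap (odd m.+1) i j (den alpha m) (den alpha m.+1 - den alpha m)
  (num alpha m) (num alpha m.+1 - num alpha m)) => //.
- lia.
- lia.
- by rewrite L0 signr_odd mulrA -expr2 sqrr_sign mul1r.
- transitivity ((-1) ^+ odd m.+1 *
    (((den alpha m)%:~R * alpha - (num alpha m)%:~R) -
     ((den alpha m.+1)%:~R * alpha - (num alpha m.+1)%:~R))).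
    by ring.
  rewrite L0 L1 signr_odd [(-1) ^+ m.+2]exprS.
  transitivity ((-1) ^+ m.+1 * (-1) ^+ m.+1 * (err alpha m + err alpha m.+1)).
    by ring.
  by rewrite -expr2 sqrr_sign mul1r.
- lra.
Qed.

End TowerBounds.

(** * One arc, and splitting it into two *)

Section Covers.
Variables (R : realType) (alpha : R).
Hypothesis irr : irrational alpha.
Local Notation den := (den alpha).
Local Notation err := (err alpha).

Lemma den_bracket_height (h N : nat) : (`|den N.+1| < h)%N ->
  exists2 n, (N < n)%N & 0 < den n /\ den n < h%:Z <= den n.+1.
Proof.
move=> hN.
(* Bracketing [h - 1] instead of [h] puts the strict inequality on the left. *)
have [|n Nn /andP[h1 h2]] := @den_bracket _ alpha irr N.+1 (h%:Z - 1).
  lia.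
exists n => //; split; last lia.
by case: n Nn {h1 h2} => // n _; exact: den_gt0.
Qed.

(** A height in [(den n, den n.+1]] limits the arc to [err n]. Conversely an arc of length [err n]
    reaches height [den n.+1] by [best_approx]. *)
Lemma covers1P z : covers 1 (rotation alpha) z <->
  forall N, exists2 n, (N <= n)%N & z <= (den n.+1)%:~R * err n.
Proof.
rewrite coversP; split => [cov N|cov h0].
  have [h [c [b [hN b01 dis zh]]]] := cov `|den N.+1|.+1.
  have [n Nn [d0 /andP[dh hd]]] := den_bracket_height hN.
  exists n; first exact: ltnW.
  apply: (le_trans zh); rewrite big_ord1.
  have bi := tower_width irr dis ord0 d0 dh.
  apply: ler_pM => //; first by case/andP: (b01 ord0) => /ltW.
  by rewrite -[h%:R]/(h%:Z%:~R) ler_int.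
have [n hn zn] := cov h0.
have d := den_ge irr n; have d0 := den_gt0 irr n.
exists `|den n.+1|%N, (fun=> 0), (fun=> err n); split.
- lia.
- by move=> i; rewrite err_gt0 // err_le1.
- move=> i j k l m kh lh; rewrite !ord1 => hm; split => //.
  apply/eqP/negPn/negP => kl.
  have lk0 : l%:Z - k%:Z != 0 by lia.
  have lkd : `|l%:Z - k%:Z| < den n.+1 by lia.
  have := best_approx irr (- m) lk0 lkd.
  rewrite leNgt ltr_norml mulrNz intrB -!pmulrn => /negP; apply.
  by move: hm => /=; lra.
- by rewrite big_ord1 natr_absz ger0_norm // ltW.
Qed.

(** Cut the single arc into two adjacent halves. *)
Lemma covers1_covers2 z :
  covers 1 (rotation alpha) z -> covers 2 (rotation alpha) z.
Proof.
rewrite !coversP => cov h0; have [h [c [b [hh b01 dis zh]]]] := cov h0.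
have /andP[b0 b1] := b01 ord0; set x := b ord0 in b0 b1.
exists h, (fun i => c ord0 + i%:R * (x / 2)), (fun=> x / 2); split => //.
- by move=> _; lra.
- have i01 (i : 'I_2) : i = ord0 \/ i = ord_max.
    by case: i => -[|[|//]] ?; [left|right]; apply/val_inj.
  move=> i j k l m kh lh hm.
  have [|_ kl] := dis ord0 ord0 k l m kh lh.
    by rewrite -/x; move: hm; case: (i01 i) => ->; case: (i01 j) => -> /=; lra.
  split => //; rewrite -kl in hm.
  have m0 : m = 0.
    apply: (@int_small R); move: hm.
    by case: (i01 i) => ->; case: (i01 j) => -> /=; lra.
  move: hm; rewrite m0.
  by case: (i01 i) => ->; case: (i01 j) => -> //= ?; exfalso; lra.
- apply: (le_trans zh); rewrite big_ord1 sumr_const card_ord -/x.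
  by rewrite mulr2n -splitr.
Qed.

End Covers.

(** * Two facts on limits of real sequences *)

Section Limits.
Variable R : realType.
Implicit Types (u d : nat -> R) (l x : R).

Lemma contraction_cvg0 d N r : 0 <= r < 1 ->
  (forall n, (N <= n)%N -> `|d n.+1| <= r * `|d n|) -> d @ \oo --> (0 : R).
Proof.
move=> /andP[r0 r1] dr.
have dN k : `|d (k + N)%N| <= `|d N| * r ^+ k.
  elim: k => [|k IH]; first by rewrite mulr1.
  rewrite addSn (le_trans (dr _ _)) ?leq_addl // exprS mulrCA.
  exact: ler_wpM2l.
rewrite -(cvg_shiftn N); apply: norm_cvg0.
apply: (@squeeze_cvgr _ _ _ _ (fun=> 0) (geometric `|d N| r)).
- by apply: nearW => k; rewrite normr_ge0 dN.
- exact: cvg_cst.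
- by apply: cvg_geometric; rewrite ger0_norm.
Qed.

Lemma cvg_frequently_ge u l x : u @ \oo --> l ->
  (forall N, exists2 n, (N <= n)%N & x <= u n) -> x <= l.
Proof.
move=> ul ux; rewrite leNgt; apply/negP => lx.
have [N _ uN] := cvgr_lt _ ul _ lx.
by have [n Nn] := ux N; rewrite leNgt uN.
Qed.

End Limits.

(** * Two arcs when the partial quotients exceed 1 *)

Section TwoArcs.
Variables (R : realType) (alpha : R).
Hypothesis irr : irrational alpha.
Local Notation cq := (complete_quotient alpha).
Local Notation pq := (partial_quotient alpha).
Local Notation den := (den alpha).
Local Notation err := (err alpha).

Let v n : R := (den n.+1)%:~R * err n.

(** Once [err n] and [den n.+3] are expanded, the difference of the two sides is exactly [(pq n.+1 -
    2) * den n.+1 * err n.+1 + (pq n.+2 - 2) * den n.+2 * err n.+2]. *)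
Lemma gap_product_le n : 1 < pq n.+1 -> 1 < pq n.+2 ->
  2 * ((den n.+1 + den n.+2)%:~R * (err n.+1 + err n.+2)) <=
  2 * v n.+1 + v n + v n.+2.
Proof.
move=> p1 p2; rewrite /v (denSS alpha n.+1) (err_rec irr n) !intrD !intrM.
have P1 : (2 : R) <= (pq n.+1)%:~R by rewrite (ler_int R 2).
have P2 : (2 : R) <= (pq n.+2)%:~R by rewrite (ler_int R 2).
have E1 := err_gt0 irr n.+1; have E2 := err_gt0 irr n.+2.
have D0 : 0 < (den n.+1)%:~R :> R by rewrite ltr0z den_gt0.
have D1 : 0 < (den n.+2)%:~R :> R by rewrite ltr0z den_gt0.
have h1 : 0 <= ((pq n.+1)%:~R - 2) * ((den n.+1)%:~R * err n.+1).
  by rewrite mulr_ge0 ?subr_ge0 // mulr_ge0 ?ltW.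
have h2 : 0 <= ((pq n.+2)%:~R - 2) * ((den n.+2)%:~R * err n.+2).
  by rewrite mulr_ge0 ?subr_ge0 // mulr_ge0 ?ltW.
rewrite denSS intrD intrM in h2 D1 *; lra.
Qed.

Lemma covers2_covers1 z : (\forall i \near \oo, 1 < pq i) ->
  covers 2 (rotation alpha) z -> covers 1 (rotation alpha) z.
Proof.
move=> [N0 _ hN0] /coversP cov; apply/(covers1P irr) => N.
have [h [c [b [hN b01 dis zh]]]] := cov `|den (maxn N N0).+2|.+1.
(* The bracket is indexed by [n.+1] because the middle range also needs [v n]; the margin in [hN]
   keeps [n] above [N] and [N0]. *)
have [[|n] // Nn [d0 /andP[dh hd]]] := den_bracket_height irr hN.
have Nn0 : (N <= n)%N by lia.
have pn i : (n <= i)%N -> 1 < pq i by move=> ni; apply: hN0 => /=; lia.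
have {}zh : z <= h%:R * (b ord0 + b ord_max).
  move: zh; rewrite big_ord_recl big_ord1.
  by congr (_ <= _ * (_ + b _)); apply/val_inj.
have b0 := tower_width irr dis ord0 d0 dh.
have b1 := tower_width irr dis ord_max d0 dh.
have h0 : 0 <= h%:R :> R by [].
have e0 := err_gt0 irr n.+1; have e1 := err_gt0 irr n.+2.
have hE : (h%:R : R) = (h%:Z)%:~R by [].
have goal1 : z <= v n.+1 -> exists2 m, (N <= m)%N & z <= (den m.+1)%:~R * err m.
  by exists n.+1 => //; exact: leqW.
(* Low towers: bounding each arc by [err n.+1] is enough. *)
have [c1|c1] := lerP (2 * h%:Z) (den n.+2).
  have {}c1 : (2 : R) * h%:R <= (den n.+2)%:~R.
    by rewrite hE -(intrM _ 2) ler_int.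
  apply: goal1; rewrite /v.
  have := ler_wpM2l h0 b0; have := ler_wpM2l h0 b1.
  have := ler_wpM2r (ltW e0) c1; lra.
(* High towers: both arcs together fit into a gap of length [err n.+1]. *)
have [c2|c2] := ltP (den n.+1 + den n.+2) (2 * h%:Z).
  have bb := tower_gap_den irr dis (isT : ord0 != ord_max :> 'I_2) c2.
  have {}hd : h%:R <= (den n.+2)%:~R :> R by rewrite hE ler_int.
  apply: goal1; rewrite /v.
  have := ler_wpM2l h0 bb; have := ler_wpM2r (ltW e0) hd; lra.
have bb := tower_gap_den1 irr dis (isT : ord0 != ord_max :> 'I_2) c1.
have {}c2 : (2 : R) * h%:R <= (den n.+1 + den n.+2)%:~R.
  by rewrite hE -(intrM _ 2) ler_int.
have zm : 4 * z <= 2 * v n.+1 + v n + v n.+2.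
  have mid : 2 * ((den n.+1 + den n.+2)%:~R * (err n.+1 + err n.+2)) <=
     2 * v n.+1 + v n + v n.+2.
    by apply: gap_product_le; apply: pn; rewrite ?leqW.
  have e01 : 0 <= err n.+1 + err n.+2 by rewrite addr_ge0 ?ltW.
  have := ler_wpM2l h0 bb; have := ler_wpM2r e01 c2; lra.
(* Middle range: [z] is at most a weighted average of three values of [v], hence at most one of
   them. *)
have [zv|zv] := lerP z (v n.+1); first exact: goal1.
have [zv'|zv'] := lerP z (v n); first by exists n.
by exists n.+2; [exact: leqW (leqW Nn0) | rewrite -/(v n.+2); lra].
Qed.

End TwoArcs.

(** * Partial quotients eventually 1: the golden case *)

Section Golden.
Variables (R : realType) (alpha : R).
Hypothesis irr : irrational alpha.
Local Notation cq := (complete_quotient alpha).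
Local Notation pq := (partial_quotient alpha).
Local Notation den := (den alpha).
Local Notation err := (err alpha).
Local Notation phi := (@golden_ratio R).

Lemma golden_sqr : phi * phi = phi + 1.
Proof.
have s5 : (Num.sqrt 5 : R) ^+ 2 = 5 by rewrite sqr_sqrtr.
transitivity ((1 + 2 * Num.sqrt 5 + (Num.sqrt 5 : R) ^+ 2) / 4).
  by rewrite /golden_ratio; field.
by rewrite s5 /golden_ratio; field.
Qed.

Lemma golden_gt : 3 / 2 < phi.
Proof.
have : 0 <= Num.sqrt 5 :> R by exact: sqrtr_ge0.
have := golden_sqr; rewrite /golden_ratio; set s := Num.sqrt 5; nra.
Qed.

Lemma golden_lt : phi < 2.
Proof. have := golden_sqr; have := golden_gt; nra. Qed.

Variable N : nat.
Hypothesis pq1 : forall i, (N <= i)%N -> pq i = 1.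

(** The map [x -> 1 + 1/x] fixes [phi] and sends each complete quotient to the previous one. It
    contracts distances to [phi], and all later quotients lie in [(1, 2)], so the distance is at
    most [(2 / 3) ^+ k] for every [k]. *)
Lemma cq_golden i : (N <= i)%N -> cq i = phi.
Proof.
have g2 := golden_sqr; have g := golden_gt.
have phi0 : 0 < phi by lra.
have cqS j : (N <= j)%N -> cq j = 1 + (cq j.+1)^-1.
  by move=> Nj; rewrite {1}cqE pq1 //= invrK.
have cq12 j : (N <= j)%N -> 1 < cq j < 2.
  move=> Nj; have := frac_itv (cq j); have := frac_cq_gt0 irr j.
  by have := cqE alpha j; rewrite pq1 // => e; lra.
have step j : (N <= j)%N -> `|cq j - phi| <= 2 / 3 * `|cq j.+1 - phi|.
  move=> Nj; rewrite cqS //; have /andP[x1 _] := cq12 j.+1 (leqW Nj).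
  set x := cq j.+1 in x1 *; have x0 : 0 < x by lra.
  have -> : 1 + x^-1 - phi = (phi - x) * (x * phi)^-1.
    have -> : 1 + x^-1 - phi = x^-1 - (phi - 1) by ring.
    have -> : phi - 1 = phi^-1.
      apply: (mulfI (lt0r_neq0 phi0)).
      by rewrite mulfV ?lt0r_neq0 // mulrBr g2; lra.
    by field; rewrite !lt0r_neq0.
  rewrite normrM mulrC distrC ler_wpM2r //.
  rewrite ger0_norm ?invr_ge0 ?mulr_ge0 ?ltW //.
  (* The factor is [1 / (x * phi)] with [x > 1] and [phi > 3 / 2]. *)
  rewrite -[ltRHS]invf_div ltf_pV2 ?posrE ?mulr_gt0 //; nra.
have bound k j : (N <= j)%N -> `|cq j - phi| <= (2 / 3) ^+ k.
  elim: k j => [|k IH] j Nj.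
    have := cq12 j Nj; have := golden_lt; rewrite ler_norml expr0; lra.
  apply: (le_trans (step j Nj)); rewrite exprS ler_wpM2l ?IH ?leqW //; lra.
move=> Ni; apply/eqP; rewrite -subr_eq0 -normr_le0.
apply: (@cvg_frequently_ge _ (fun k => (2 / 3) ^+ k)).
  by apply: cvg_expr; rewrite ger0_norm; lra.
by move=> M; exists M => //; exact: bound.
Qed.

Lemma err_golden n : (N <= n)%N -> err n = phi * err n.+1.
Proof.
move=> Nn; have /= <- := cq_golden (leqW Nn).
by rewrite mulrCA mulVf ?mulr1 // lt0r_neq0 // frac_cq_gt0.
Qed.

Lemma err_cvg0 : err @ \oo --> (0 : R).
Proof.
have g := golden_gt.
apply: (@contraction_cvg0 _ _ N (2 / 3)) => [|n Nn]; first lra.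
have e := err_gt0 irr n.+1.
have pe : 0 < phi * err n.+1 by apply: mulr_gt0; lra.
by rewrite (err_golden Nn) !gtr0_norm //; nra.
Qed.

(** With [err n = phi * err n.+1], [den_err] becomes an affine recurrence for these products, with
    multiplier [- 1 / phi ^ 2] and fixed point [phi / (phi + 2)]. *)
Lemma den_err_cvg : (fun n => (den n)%:~R * err n) @ \oo -->
  phi / (phi + 2).
Proof.
have g2 := golden_sqr; have g := golden_gt.
pose d n := (den n)%:~R * err n - phi / (phi + 2).
have phi0 : phi != 0 by rewrite gt_eqF //; lra.
have phi2 : phi + 2 != 0 by rewrite gt_eqF //; lra.
have dS n : (N <= n)%N -> phi * phi * d n.+1 = - d n.
  move=> Nn.
  have e : phi * ((den n.+1)%:~R * err n.+1) + (den n)%:~R * err n / phi = 1.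
    rewrite -[RHS](den_err irr n) (err_golden Nn).
    by field.
  rewrite /d.
  have -> : (den n)%:~R * err n =
      phi * (1 - phi * ((den n.+1)%:~R * err n.+1)).
    by rewrite -[LHS](divfK phi0) mulrC; congr (phi * _); lra.
  set U := (den n.+1)%:~R * err n.+1.
  have key : phi * phi * (phi / (phi + 2)) = phi - phi / (phi + 2).
    by rewrite g2; field.
  by rewrite mulrBr key; ring.
suff d0 : d @ \oo --> (0 : R).
  rewrite -[X in _ --> X]add0r.
  have -> : (fun n => (den n)%:~R * err n) =
      (fun n => d n + phi / (phi + 2)).
    by apply/funext => n; rewrite /d subrK.
  by apply: cvgD => //; exact: cvg_cst.
apply: (@contraction_cvg0 _ _ N (2 / 3)) => [|n Nn]; first lra.
rewrite -[`|d n|]normrN -dS // normrM ger0_norm; last nra.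
have := normr_ge0 (d n.+1); nra.
Qed.

Lemma covers1_golden z : covers 1 (rotation alpha) z ->
  z <= phi * (phi / (phi + 2)).
Proof.
move=> /(covers1P irr) cov.
apply: (@cvg_frequently_ge _ (fun n => phi * ((den n.+1)%:~R * err n.+1))).
  apply: cvgM; first exact: cvg_cst.
  by rewrite (cvg_shiftS (fun n => (den n)%:~R * err n)); exact: den_err_cvg.
move=> M; have [n nM zn] := cov (maxn M N).
exists n; first by lia.
by rewrite mulrCA -err_golden //; lia.
Qed.

Lemma err_golden3 n : (N <= n)%N -> err n = phi * phi * phi * err n.+3.
Proof.
move=> Nn; rewrite (err_golden Nn) (err_golden (leqW Nn)).
by rewrite (err_golden (leqW (leqW Nn))) !mulrA.
Qed.

Lemma den_golden n : (N <= n)%N -> den n.+2 = den n.+1 + den n.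
Proof. by move=> Nn; rewrite denSS pq1 ?leqW // mul1r. Qed.

Let L : R := (4 * phi + 3) / 10.

Lemma half_den_err_cvg : (fun n => (den n.+3)%:~R * err n / 2) @ \oo --> L.
Proof.
have g2 := golden_sqr; have g := golden_gt.
have phi2 : phi + 2 != 0 by rewrite gt_eqF //; lra.
have LE : L = phi * phi * phi / 2 * (phi / (phi + 2)).
  transitivity (phi * phi * (phi * phi) / (2 * (phi + 2))); last by field.
  apply: (mulIf phi2); rewrite g2 /L.
  transitivity ((8 * (phi * phi) + 22 * phi + 12) / 20); first by field.
  transitivity ((phi * phi + 2 * phi + 1) / 2); last by field.
  by rewrite g2; field.
rewrite LE; apply: (@cvg_trans _ ((fun n => phi * phi * phi / 2 *
    ((den n.+3)%:~R * err n.+3)) @ \oo)).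
  apply: near_eq_cvg; exists N => // n Nn.
  by rewrite (@err_golden3 n Nn); field.
apply: cvgM; first exact: cvg_cst.
rewrite (cvg_shiftS (fun n => (den n.+2)%:~R * err n.+2)).
rewrite (cvg_shiftS (fun n => (den n.+1)%:~R * err n.+1)).
by rewrite (cvg_shiftS (fun n => (den n)%:~R * err n)); exact: den_err_cvg.
Qed.

Lemma covers2_golden_le z : covers 2 (rotation alpha) z -> z <= L.
Proof.
move=> /coversP cov; apply: (cvg_frequently_ge half_den_err_cvg) => M.
have [h [c [b [hN b01 dis zh]]]] := cov `|den (maxn M N).+2|.+1.
(* Bracketing [2 * h - 1] gives [den n.+2 < 2 * h <= den n.+3]. As [den n.+2 = den n + den n.+1],
   the gap is at most [err n]. *)
have [|m mM /andP[dh hd]] :=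
  @den_bracket _ alpha irr (maxn M N).+2 (2 * h%:Z - 1).
  lia.
case: m mM dh hd => [|[|n]] // nM dh hd.
exists n; first lia.
rewrite den_golden in dh; last lia.
have dh' : den n + den n.+1 < 2 * h%:Z by lia.
have bb := tower_gap_den irr dis (isT : ord0 != ord_max :> 'I_2) dh'.
have {}hd : (2 : R) * h%:R <= (den n.+3)%:~R.
  have -> : (h%:R : R) = (h%:Z)%:~R by [].
  by rewrite -(intrM _ 2) ler_int; lia.
have {}zh : z <= h%:R * (b ord0 + b ord_max).
  move: zh; rewrite big_ord_recl big_ord1.
  by congr (_ <= _ * (_ + b _)); apply/val_inj.
have h0 : 0 <= h%:R :> R by [].
have e0 := err_gt0 irr n.
have := ler_wpM2l h0 bb; have := ler_wpM2r (ltW e0) hd; lra.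
Qed.

(** A gap of length [err n] left by the points [t * alpha] with [|t| < h] is filled exactly by arcs
    of lengths [err n.+1] and [err n.+2], with [h] the integer part of [den n.+3 / 2]. *)
Lemma covers2_golden_ge z : z < L -> covers 2 (rotation alpha) z.
Proof.
move=> zL; apply/coversP => h0.
(* The subtracted [err n] pays for rounding [den n.+3 / 2] down to [h]. *)
have : (fun n => (den n.+3)%:~R * err n / 2 - err n) @ \oo --> L - 0.
  by apply: cvgB; [exact: half_den_err_cvg | exact: err_cvg0].
rewrite subr0 => /cvgr_gt /(_ _ zL) [M _ hM].
pose n := (maxn M (maxn N (2 * h0).+2)).
have zn : z < (den n.+3)%:~R * err n / 2 - err n by apply: hM => /=; lia.
have Nn : (N <= n)%N by lia.
have dE := den_golden Nn; have dE' := den_golden (leqW Nn).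
have d0 := den_ge0 irr n; have d1 := den_gt0 irr n.
have d2 := den_gt0 irr n.+1; have d3 := den_ge irr n.+2.
have d12 := den_le irr n.+1.
have [h hE] : exists h : nat, 2 * h%:Z <= den n.+3 <= 2 * h%:Z + 1.
  by exists `|(den n.+3 %/ 2)%Z|%N; lia.
have e0 := err_gt0 irr n.
have eE : err n = err n.+1 + err n.+2.
  by rewrite (err_rec irr n) pq1 ?leqW // mul1r.
have e1 := err_gt0 irr n.+1; have e2 := err_gt0 irr n.+2.
have e12 := err_ltS irr n.+1.
(* [gap_between] leaves a gap beside 0 for [- den n.+1 < j < den n + den n.+1]. The shift by [k0]
   moves this range to [- h < t < den n.+3 - h], which contains all [|t| < h]. The parity of [n]
   decides on which side of [k0 * alpha] the gap lies. *)
pose k0 : int := den n.+1 - h%:Z.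
pose u : R := k0%:~R * alpha - (if odd n then 0 else err n).
have nogap (t m : int) :
    `|t| < h%:Z -> u < t%:~R * alpha + m%:~R < u + err n -> False.
  move=> th hm.
  suff : den n + den n.+1 <= t - k0 \/ t - k0 <= - den n.+1 by lia.
  apply: (@gap_between _ alpha irr n _ (- m)).
  rewrite intrB mulrNz exprS -signr_odd.
  by move: hm; rewrite /u; case: (odd n); rewrite ?expr1 ?expr0; lra.
pose c (i : 'I_2) : R := if val i is 0 then u + err n.+2 else 0.
pose b (i : 'I_2) : R := if val i is 0 then err n.+1 else err n.+2.
have bE : \sum_i b i = err n by rewrite big_ord_recl big_ord1.
exists h, c, b; split.
- lia.
- move=> i; have := err_le1 irr n.+1; have := err_le1 irr n.+2.
  by rewrite /b; case: (val i) => [|_]; lra.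
- move=> i j k l m kh lh hm.
  pose t := l%:Z - k%:Z.
  have tR : (t%:~R : R) = l%:R - k%:R by rewrite intrB -!pmulrn.
  have tR' : ((- t)%:~R : R) = k%:R - l%:R by rewrite mulrNz tR opprB.
  have [ij|ij] := eqVneq i j.
    split=> //; apply/eqP/negPn/negP => kl.
    have t0 : t != 0 by lia.
    (* Here [2 * h <= den n.+3 <= 2 * den n.+2]; so [best_approx] separates the levels of each arc
       by at least [err n.+1]. *)
    have td : `|t| < den n.+2 by lia.
    have := best_approx irr (- m) t0 td.
    rewrite leNgt ltr_norml mulrNz tR => /negP; apply.
    move: hm; rewrite -ij /b; case: (val i) => [|_]; lra.
  exfalso; move: ij hm; rewrite -val_eqE /c /b.
  case: i j => -[|[|//]] ? [[|[|//]] ?] //= _ hm.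
    apply: (nogap t m); [lia | rewrite tR; lra].
  apply: (nogap (- t) (- m)); [lia | rewrite tR' mulrNz; lra].
- rewrite bE.
  have {}hE : (den n.+3)%:~R <= (2 : R) * h%:R + 1.
    have -> : (h%:R : R) = (h%:Z)%:~R by [].
    by rewrite -(intrM _ 2) -(intrD _ _ 1) ler_int; lia.
  have := ler_wpM2r (ltW e0) hE; lra.
Qed.

Lemma covering_number2_golden : covering_number 2 (rotation alpha) = L%:E.
Proof.
apply/eqP; rewrite eq_le; apply/andP; split.
  by apply: ge_ereal_sup => _ [z /covers2_golden_le zL <-]; rewrite lee_fin.
(* Covering is established only for [z] strictly below [L], so the supremum is approached from
   below. *)
apply/lee_subgt0Pr => e e0; apply: ereal_sup_ubound.
exists (L - e); last by rewrite EFinB.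
by apply: covers2_golden_ge; lra.
Qed.

Lemma covering_number1_golden : (covering_number 1 (rotation alpha) < L%:E)%E.
Proof.
have g2 := golden_sqr; have g := golden_gt.
apply: (@le_lt_trans _ _ (phi * (phi / (phi + 2)))%:E).
  by apply: ge_ereal_sup => _ [z /covers1_golden zL <-]; rewrite lee_fin.
rewrite lte_fin mulrA ltr_pdivrMr ?addr_gt0 //; last lra.
(* Modulo [phi * phi = phi + 1] the claim reads [phi + 1 < 3 / 2 * phi + 1]. *)
by rewrite g2 /L; nra.
Qed.

End Golden.

Theorem theorem1p6 (R : realType) (alpha : R) (alpha_irr : irrational alpha) :
  ((\forall i \near \oo, partial_quotient alpha i = 1) ->
     [/\ covering_number 2 (rotation alpha) =
           ((4 * golden_ratio + 3) / 10)%:E,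
         ((4 * golden_ratio + 3) / 10 : R) = (2 * Num.sqrt 5 + 5) / 10
       & (covering_number 1 (rotation alpha) <
          covering_number 2 (rotation alpha))%E]) /\
  ((\forall i \near \oo, (1 < partial_quotient alpha i)) ->
     covering_number 2 (rotation alpha) = covering_number 1 (rotation alpha)).
Proof.
split=> [[N _ pq1]|pq2].
  have F2 := covering_number2_golden alpha_irr pq1.
  split=> //; first by rewrite /golden_ratio; field.
  by rewrite F2; exact: covering_number1_golden pq1.
rewrite /covering_number; congr (ereal_sup [set z%:E | z in _]).
apply/seteqP; split => z /=; first exact: covers2_covers1.
exact: covers1_covers2.
Qed.
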